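(* Let $a>0$ and $b>0$, and let $\pi=\mathrm{PBD}(a;0,1,b)$. For each $f\in\mathcal{F}$, let $\tilde g_f:\mathbb{Z}_+\to\mathbb{R}$ be the solution of Stein's equation $$a\,\tilde g_f(i+1)-[i+bi(i-1)]\,\tilde g_f(i)=f(i)-\pi(f),\qquad i\in\mathbb{Z}_+,$$ with the convention $\tilde g_f(0)=\tilde g_f(1)$. Then $$\sup_{f\in\mathcal{F}}\|\tilde g_f\|\le\min\left\{\frac{1}{1+\frac{2ab}{a+2b+2}},\ \frac{\sqrt{ab+(b-1)^2/4}+(b-1)/2}{ab}\right\},$$ $$\sup_{f\in\mathcal{F}}\|\Delta\tilde g_f\|\le\min\left\{\frac{1}{1+b}+\frac{a+2b}{a^2+2a+2+2b(a+1)},\ \frac{1}{\sqrt{ab}}+\frac1a\right\},$$ $$\sup_{f\in\mathcal{F}}\|\Delta^2\tilde g_f\|\le\frac2a+\frac{b}{(a+1)b+1+a/2}.$$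
   Context: $\mathbb{Z}_+=\{0,1,2,\dots\}$. $\mathcal{F}$ is the set of functions $f:\mathbb{Z}_+\to\mathbb{R}$ with $|f(x)-f(y)|\le|x-y|$ for all $x,y\in\mathbb{Z}_+$. For a function $g$ on $\mathbb{Z}_+$, $\Delta g(i)=g(i+1)-g(i)$, $\Delta^2 g=\Delta(\Delta g)$, and $\|g\|=\sup_{i\in\mathbb{Z}_+}|g(i)|$. The polynomial birth-death distribution $\mathrm{PBD}(a;0,1,b)$ is the probability distribution $\pi=(\pi_n)_{n\in\mathbb{Z}_+}$ on $\mathbb{Z}_+$ given by $$\pi_n=\frac{\prod_{i=0}^{n-1}\alpha_i}{\prod_{i=1}^n\beta_i}\left(1+\sum_{j=1}^\infty\frac{\prod_{i=0}^{j-1}\alpha_i}{\prod_{i=1}^j\beta_i}\right)^{-1},\qquad \alpha_i=a,\quad \beta_i=i+bi(i-1).$$ For a function $f$ with $\sum_i|f(i)|\pi_i<\infty$, $\pi(f)=\sum_{i=0}^\infty f(i)\pi_i$. *)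

(* Defs.v *)
From Stdlib Require Import Reals List.
From Coquelicot Require Import Coquelicot.
Open Scope R_scope.

(* [prod_from u m n] is the product of the [n] factors u_m, ..., u_{m+n-1}. *)
Definition prod_from (u : nat -> R) (m n : nat) : R :=
  fold_right Rmult 1 (map u (seq m n)).

Definition bd_weight (alpha beta : nat -> R) (n : nat) : R :=
  prod_from alpha 0 n / prod_from beta 1 n.

Definition bd_distribution (alpha beta : nat -> R) (n : nat) : R :=
  bd_weight alpha beta n
  * / (1 + Series (fun j => bd_weight alpha beta (S j))).

Definition death_rate (b : R) (i : nat) : R :=
  INR i + b * INR i * (INR i - 1).

(* PBD(a; 0, 1, b): birth rates a, death rates 0 + 1 * i + b * i (i - 1). *)
Definition pbd (a b : R) : nat -> R :=
  bd_distribution (fun _ => a) (death_rate b).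

Definition expect (p f : nat -> R) : R := Series (fun i => f i * p i).

Definition lipschitz1 (f : nat -> R) : Prop :=
  forall x y : nat, Rabs (f x - f y) <= Rabs (INR x - INR y).

(* The equation at i = 0 determines g 1 and then, recursively, g (i + 1) for
   every i (the coefficient of g 0 is zero), so together with the convention
   g 0 = g 1 this has exactly one solution g for each f. *)
Definition stein_solution (a b : R) (f g : nat -> R) : Prop :=
  (forall i : nat,
     a * g (S i) - death_rate b i * g i = f i - expect (pbd a b) f)
  /\ g 0%nat = g 1%nat.

Definition delta (g : nat -> R) (i : nat) : R := g (S i) - g i.

(* Suprema are taken in the extended reals, so that a finite upper bound
   includes the assertion that the supremum is finite. *)
Definition sup_norm (g : nat -> R) : Rbar :=
  Sup_seq (fun i => Finite (Rabs (g i))).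

Definition sup_lipschitz1 (N : (nat -> R) -> Rbar) : Rbar :=
  Rbar_lub (fun x : Rbar => exists f : nat -> R, lipschitz1 f /\ x = N f).

(* Main.v *)
Require Import Defs.
From Stdlib Require Import Reals List Lra Lia.
From Coquelicot Require Import Coquelicot.
Open Scope R_scope.

(* Increments of a solution [g] satisfy [L g = Delta f], where [L] is the generator
   of a killed birth-death process; since the death rates have constant second
   difference, each further difference of [g] satisfies an equation of the same
   kind with a larger killing rate.  Solutions with the right centring decay at
   infinity, so the maximum principle applies: minus the solution [h] for
   [f x = x] is nonnegative, decreasing and convex, with convex differences up to
   third order, and
     |g_f (k+1)| <= - h 1,
     |Delta g_f (k+1)| <= 2 D + (h 2 - h 1),
     |Delta^2 g_f (k+1)| <= 2 / a - (h 3 - 2 h 2 + h 1),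
   where [D] is the increment of minus the solution for
   [f x = max (x - (k+1)) 0] at its kink.  The recursion gives [h 2] and [h 3] in
   terms of [h 1 = - mu / a], and the sign conditions [h 3 <= 0], [h 2 <= h 3],
   together with the Jensen inequality [mu + b (mu^2 - mu) <= a], are exactly the
   estimates on the mean [mu] that the stated constants require. *)

(** * Death rates, weights, Stein's equation and elementary limits *)

Lemma death_rate_0 (b : R) : death_rate b 0 = 0.
Proof. unfold death_rate; simpl; ring. Qed.

Lemma death_rate_S (b : R) (k : nat) :
  death_rate b (S k) = death_rate b k + (1 + 2 * b * INR k).
Proof. unfold death_rate; rewrite S_INR; ring. Qed.

Lemma death_rate_ge_INR (b : R) (hb : 0 < b) (k : nat) :
  INR k <= death_rate b k.
Proof.
induction k as [|k IH].
- rewrite death_rate_0; simpl; lra.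
- rewrite death_rate_S, S_INR.
  assert (0 <= b * INR k) by (apply Rmult_le_pos; [lra | apply pos_INR]).
  lra.
Qed.

Lemma death_rate_nonneg (b : R) (hb : 0 < b) (k : nat) : 0 <= death_rate b k.
Proof.
apply Rle_trans with (INR k); [apply pos_INR | now apply death_rate_ge_INR].
Qed.

(** The constant [c] is free, so that comparison arguments never involve [pbd]. For Lipschitz [f]
    and positive [a], [b], decay of [g] forces [c] to be the mean of [f]. *)
Definition stein_eq (a b : R) (f g : nat -> R) (c : R) : Prop :=
  forall i : nat, a * g (S i) - death_rate b i * g i = f i - c.

Definition decaying_solution (a b : R) (f g : nat -> R) (c : R) : Prop :=
  stein_eq a b f g c /\ is_lim_seq g 0.

Lemma prod_from_S (u : nat -> R) (m n : nat) :
  prod_from u m (S n) = prod_from u m n * u (m + n)%nat.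
Proof.
unfold prod_from; rewrite seq_S, map_app, fold_right_app; simpl.
generalize (map u (seq m n)) as l.
induction l as [|x l IH]; simpl; [ring | rewrite IH; ring].
Qed.

Lemma bd_weight_0 (alpha beta : nat -> R) : bd_weight alpha beta 0 = 1.
Proof. unfold bd_weight, prod_from; simpl; field. Qed.

(* Division is total, so this also holds when some death rate vanishes. *)
Lemma bd_weight_S (alpha beta : nat -> R) (n : nat) :
  bd_weight alpha beta (S n) = bd_weight alpha beta n * (alpha n / beta (S n)).
Proof.
unfold bd_weight; rewrite !prod_from_S; unfold Rdiv.
rewrite Rinv_mult; simpl; ring.
Qed.

Lemma is_lim_seq_const_div_INR (K : R) :
  is_lim_seq (fun n => K / INR (S n)) 0.
Proof.
replace (Finite 0) with (Rbar_mult (Finite K) (Rbar_inv p_infty))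
  by (simpl; f_equal; ring).
apply is_lim_seq_scal_l, is_lim_seq_inv; [|discriminate].
apply (is_lim_seq_incr_1 INR), is_lim_seq_INR.
Qed.

Lemma is_lim_seq_0_eventually (u : nat -> R) (e : R) :
  is_lim_seq u 0 -> 0 < e ->
  exists N, forall n, (N <= n)%nat -> Rabs (u n) < e.
Proof.
intros Hu He.
destruct (proj2 (is_lim_seq_spec u 0) Hu (mkposreal e He)) as [N HN].
exists N; intros n Hn; specialize (HN n Hn); simpl in HN.
now rewrite Rminus_0_r in HN.
Qed.

Lemma lipschitz1_growth (f : nat -> R) (n : nat) :
  lipschitz1 f -> Rabs (f n - f 0%nat) <= INR n.
Proof.
intros Hf; specialize (Hf n 0%nat); simpl in Hf.
rewrite Rminus_0_r, (Rabs_right (INR n)) in Hf; [exact Hf|].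
apply Rle_ge, pos_INR.
Qed.

(** * Decay of Stein solutions at infinity *)

Section Decay.

Context (a b : R) (ha : 0 < a) (hb : 0 < b).

Let W := bd_weight (fun _ => a) (death_rate b).

Lemma weight_S (n : nat) :
  W (S n) = W n * (a / (INR (S n) * (1 + b * INR n))).
Proof.
unfold W; rewrite bd_weight_S; do 2 f_equal.
unfold death_rate; rewrite S_INR; ring.
Qed.

Lemma weight_pos (n : nat) : 0 < W n.
Proof.
induction n as [|n IH]; [unfold W; rewrite bd_weight_0; lra|].
rewrite weight_S; apply Rmult_lt_0_compat; [exact IH|].
assert (0 <= b * INR n) by (apply Rmult_le_pos; [lra | apply pos_INR]).
apply Rdiv_lt_0_compat; [exact ha|].
apply Rmult_lt_0_compat; [apply lt_0_INR; lia | lra].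
Qed.

(** Ratio test: the ratio of consecutive terms is at most [2 * a / (n + 1)]. *)
Lemma ex_series_linear_weight : ex_series (fun n => INR (S n) * W n).
Proof.
apply ex_series_ext with (fun n => Rabs (INR (S n) * W n)).
{ intros n; apply Rabs_right, Rle_ge, Rmult_le_pos.
  apply pos_INR. apply Rlt_le, weight_pos. }
assert (Hpos : forall n, 0 < INR (S n) * W n).
{ intros n; apply Rmult_lt_0_compat; [apply lt_0_INR; lia | apply weight_pos]. }
apply ex_series_DAlembert with 0; [lra | |].
- intros n; specialize (Hpos n); lra.
- apply is_lim_seq_le_le with (fun _ => 0) (fun n => (2 * a) / INR (S n)).
  + intros n; split; [apply Rabs_pos|].
    rewrite Rabs_right
      by (apply Rle_ge, Rlt_le, Rdiv_lt_0_compat; apply Hpos).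
    rewrite weight_S.
    assert (Hn := pos_INR n).
    assert (Hbn : 0 <= b * INR n) by (apply Rmult_le_pos; lra).
    assert (HW := weight_pos n).
    rewrite !S_INR.
    replace ((INR n + 1 + 1) * (W n * (a / ((INR n + 1) * (1 + b * INR n))))
             / ((INR n + 1) * W n))
      with (a * ((INR n + 2) / ((INR n + 1) * (1 + b * INR n))) / (INR n + 1))
      by (field; lra).
    apply Rmult_le_compat_r; [apply Rlt_le, Rinv_0_lt_compat; lra|].
    rewrite (Rmult_comm 2); apply Rmult_le_compat_l; [lra|].
    apply Rle_div_l; nra.
  + apply is_lim_seq_const.
  + apply is_lim_seq_const_div_INR.
Qed.

Lemma ex_series_growth_weight (f : nat -> R) (C : R) :
  (forall n, Rabs (f n) <= C * INR (S n)) -> ex_series (fun n => f n * W n).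
Proof.
intros Hf; apply (ex_series_le (V := R_CompleteNormedModule))
  with (fun n => C * (INR (S n) * W n)).
- intros n; unfold norm; simpl; unfold abs; simpl.
  rewrite Rabs_mult, (Rabs_right (W n)), <- Rmult_assoc
    by (apply Rle_ge, Rlt_le, weight_pos).
  apply Rmult_le_compat_r; [apply Rlt_le, weight_pos | apply Hf].
- apply (ex_series_scal (V := R_NormedModule) C), ex_series_linear_weight.
Qed.

Lemma ex_series_weight : ex_series W.
Proof.
apply ex_series_ext with (fun n => 1 * W n); [intros n; apply Rmult_1_l|].
apply (ex_series_growth_weight (fun _ => 1) 1).
intros n; rewrite Rabs_R1, Rmult_1_l, S_INR; generalize (pos_INR n); lra.
Qed.

Lemma series_weight_pos : 0 < Series W.
Proof.
rewrite Series_incr_1 by apply ex_series_weight.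
assert (0 <= Series (fun k => W (S k))).
{ rewrite <- (Rmult_0_l (Series (fun k => W (S k)))), <- Series_scal_l.
  apply Series_le.
  - intros n; generalize (weight_pos (S n)); lra.
  - apply (ex_series_incr_1 W), ex_series_weight. }
generalize (weight_pos 0); lra.
Qed.

Lemma expect_pbd (f : nat -> R) :
  expect (pbd a b) f * Series W = Series (fun n => f n * W n).
Proof.
assert (HZ := series_weight_pos).
unfold expect, pbd, bd_distribution; fold W.
replace (1 + Series (fun j => W (S j))) with (Series W)
  by (rewrite Series_incr_1 by apply ex_series_weight;
      unfold W at 1; now rewrite bd_weight_0).
rewrite (Series_ext _ (fun n => f n * W n * / Series W)) by (intros; ring).
rewrite Series_scal_r; field; lra.
Qed.

(* Multiplying Stein's equation by the weights makes it telescope; the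
   partial sums tend to zero because the right-hand side is centred. *)
Lemma weighted_solution_lim (f g : nat -> R) (C : R) :
  (forall n, Rabs (f n) <= C * INR (S n)) -> stein_solution a b f g ->
  is_lim_seq (fun n => W n * (a * g (S n))) 0.
Proof.
intros Hf [Hg _]; set (c := expect (pbd a b) f) in *.
apply is_lim_seq_ext with (sum_n (fun n => f n * W n - c * W n)).
{ intros n; induction n as [|n IH].
  - rewrite sum_O; generalize (Hg 0%nat); rewrite death_rate_0; intros H.
    replace (a * g 1%nat) with (f 0%nat - c) by lra; ring.
  - rewrite sum_Sn, IH; unfold plus; simpl.
    generalize (Hg (S n)); intros H.
    replace (a * g (S (S n)))
      with (f (S n) - c + death_rate b (S n) * g (S n)) by lra.
    replace (W n * (a * g (S n)))
      with (W (S n) * (death_rate b (S n) * g (S n))); [ring|].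
    rewrite weight_S; unfold death_rate.
    assert (Hn := pos_INR n).
    assert (0 <= b * INR n) by (apply Rmult_le_pos; lra).
    rewrite S_INR; field; split; lra. }
assert (H : is_series (fun n => f n * W n - c * W n) 0).
{ replace 0 with (Series (fun n => f n * W n) - c * Series W)
    by (unfold c; rewrite expect_pbd; ring).
  apply (is_series_minus (V := R_NormedModule)).
  - apply Series_correct, ex_series_growth_weight with C, Hf.
  - apply (is_series_scal (V := R_NormedModule) c), Series_correct, ex_series_weight. }
exact H.
Qed.

(** [W n * (a * g (S n))] is minus the tail sum of [(f - c) * W], and the factor [1 + b * n] in the
    weight ratio makes this tail comparable to the bound on its first term. *)
Lemma stein_solution_bound (f g : nat -> R) (C : R) :
  0 <= C ->
  (forall n, Rabs (f n) <= C * INR (S n)) ->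
  (forall n, Rabs (f n - expect (pbd a b) f) <= C * INR (S n)) ->
  stein_solution a b f g ->
  exists N, forall n, (N <= n)%nat -> Rabs (g (S n)) <= 4 * C / (1 + b * INR n).
Proof.
intros HC Hf Hfc Hg.
assert (Hlim := weighted_solution_lim f g C Hf Hg).
destruct Hg as [Hg _]; set (c := expect (pbd a b) f) in *.
(* From this index on [4 * a <= 1 + b * n], which makes [w] below at least halve at each step. *)
destruct (INR_unbounded (4 * a / b)) as [N HN].
set (r := fun n => W n * (a * g (S n))) in *.
set (w := fun n => 2 * C * INR (S n) * W n).
assert (Hden : forall n, 0 < 1 + b * INR n).
{ intros n; assert (0 <= b * INR n)
    by (apply Rmult_le_pos; [lra | apply pos_INR]); lra. }
assert (Hr : forall n, r (S n) - r n = (f (S n) - c) * W (S n)).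
{ intros n; unfold r; rewrite <- (Hg (S n)).
  replace (W n * (a * g (S n)))
    with (W (S n) * (death_rate b (S n) * g (S n))); [ring|].
  rewrite weight_S; unfold death_rate.
  assert (Hn := pos_INR n); specialize (Hden n).
  rewrite S_INR; field; split; lra. }
(* Halving turns the bound on a single increment of [r] into a telescoping difference. *)
assert (Hw : forall n, (N <= n)%nat -> C * INR (S n) * W n <= w n - w (S n)).
{ intros n Hn; unfold w; rewrite weight_S.
  assert (Hn0 := pos_INR n); assert (HW := weight_pos n).
  assert (Hbn : 4 * a <= 1 + b * INR n).
  { apply le_INR in Hn.
    assert (4 * a / b <= INR n) by lra.
    apply Rle_div_l in H; lra. }
  rewrite !S_INR.
  assert (Hq : (INR n + 2) * (a / ((INR n + 1) * (1 + b * INR n)))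
               <= (INR n + 1) / 2).
  { replace ((INR n + 2) * (a / ((INR n + 1) * (1 + b * INR n))))
      with (((INR n + 2) * a) / ((INR n + 1) * (1 + b * INR n)))
      by (field; lra).
    apply Rle_div_l; [apply Rmult_lt_0_compat; lra|].
    apply Rle_trans with ((INR n + 2) / 2 * (2 * a)); [lra|].
    assert ((INR n + 2) / 2 <= (INR n + 1)) by lra.
    assert (2 * a <= (INR n + 1) / 2 * (1 + b * INR n)) by nra.
    apply Rle_trans with ((INR n + 1) * (2 * a)); [nra|].
    nra. }
  assert (0 <= C * W n) by (apply Rmult_le_pos; lra).
  generalize (Rmult_le_compat_l (2 * (C * W n)) _ _ ltac:(lra) Hq). lra. }
assert (Htail : forall m n, (N <= S n)%nat ->
          Rabs (r n) <= Rabs (r (n + m)%nat) + w (S n) - w (S (n + m))).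
{ intros m; induction m as [|m IH]; intros n Hn.
  - rewrite Nat.add_0_r; lra.
  - rewrite Nat.add_succ_r.
    specialize (IH n Hn).
    assert (Hstep : Rabs (r (n + m)%nat) <=
              Rabs (r (S (n + m))) + C * INR (S (S (n + m))) * W (S (n + m))).
    { replace (r (n + m)%nat)
        with (r (S (n + m)) - (r (S (n + m)) - r (n + m)%nat)) by ring.
      eapply Rle_trans; [apply Rabs_triang|].
      rewrite Rabs_Ropp, Hr, Rabs_mult, (Rabs_right (W _))
        by (apply Rle_ge, Rlt_le, weight_pos).
      apply Rplus_le_compat_l, Rmult_le_compat_r;
        [apply Rlt_le, weight_pos | apply Hfc]. }
    generalize (Hw (S (n + m)) ltac:(lia)); lra. }
assert (Hrw : forall n, (N <= n)%nat -> Rabs (r n) <= w (S n)).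
{ intros n Hn; apply le_epsilon; intros e He.
  destruct (is_lim_seq_0_eventually r e Hlim He) as [M HM].
  generalize (HM (n + M)%nat ltac:(lia)) (Htail M n ltac:(lia)).
  assert (0 <= w (S (n + M))).
  { unfold w; apply Rmult_le_pos; [|apply Rlt_le, weight_pos].
    apply Rmult_le_pos; [lra | apply pos_INR]. }
  lra. }
exists N; intros n Hn; specialize (Hrw n Hn); unfold r, w in Hrw.
rewrite weight_S in Hrw.
assert (HW := weight_pos n); specialize (Hden n); assert (Hn0 := pos_INR n).
rewrite !Rabs_mult, (Rabs_right (W n)), (Rabs_right a) in Hrw by lra.
apply Rmult_le_reg_l with (W n * a); [nra|].
rewrite Rmult_assoc.
eapply Rle_trans; [exact Hrw|].
rewrite !S_INR.
replace (2 * C * (INR n + 1 + 1) * (W n * (a / ((INR n + 1) * (1 + b * INR n)))))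
  with (W n * a * (2 * C * (INR n + 2) / (INR n + 1)) / (1 + b * INR n))
  by (field; lra).
unfold Rdiv at 1 3; rewrite <- Rmult_assoc.
apply Rmult_le_compat_r; [apply Rlt_le, Rinv_0_lt_compat; lra|].
apply Rmult_le_compat_l; [nra|].
apply Rle_div_l; nra.
Qed.

(** [f] grows at most linearly and the death rates quadratically, so [g] is of order [1 / n]. *)
Lemma stein_solution_decaying (f g : nat -> R) :
  lipschitz1 f -> stein_solution a b f g ->
  decaying_solution a b f g (expect (pbd a b) f).
Proof.
intros Hf Hg; split; [exact (proj1 Hg)|].
set (c := expect (pbd a b) f).
pose (C := 1 + Rabs (f 0%nat) + Rabs (f 0%nat - c)).
assert (H0 := Rabs_pos (f 0%nat)); assert (H1 := Rabs_pos (f 0%nat - c)).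
assert (HC : 0 <= C) by (unfold C; lra).
destruct (stein_solution_bound f g C HC) as [N HN]; auto.
- intros n; replace (f n) with (f n - f 0%nat + f 0%nat) by ring.
  eapply Rle_trans; [apply Rabs_triang|].
  generalize (lipschitz1_growth f n Hf) (pos_INR n); rewrite S_INR.
  unfold C; nra.
- intros n; fold c; replace (f n - c) with (f n - f 0%nat + (f 0%nat - c)) by ring.
  eapply Rle_trans; [apply Rabs_triang|].
  generalize (lipschitz1_growth f n Hf) (pos_INR n); rewrite S_INR.
  unfold C; nra.
- apply is_lim_seq_incr_1, is_lim_seq_incr_1, is_lim_seq_abs_0.
  apply is_lim_seq_le_le_loc with (fun _ => 0) (fun n => (4 * C / b) / INR (S n)).
  + exists N; intros n Hn; split; [apply Rabs_pos|].
    eapply Rle_trans; [apply HN; lia|].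
    assert (0 < INR (S n)) by (apply lt_0_INR; lia).
    assert (0 < b * INR (S n)) by now apply Rmult_lt_0_compat.
    replace (4 * C / b / INR (S n)) with (4 * C / (b * INR (S n)))
      by (field; lra).
    apply Rmult_le_compat_l; [lra|].
    apply Rinv_le_contravar; lra.
  + apply is_lim_seq_const.
  + apply is_lim_seq_const_div_INR.
Qed.

End Decay.

(** * Maximum principle and recursive comparison *)

Lemma is_lim_seq_bounded (u : nat -> R) (l : R) :
  is_lim_seq u l -> exists K, forall n, Rabs (u n) <= K.
Proof.
intros Hu.
destruct (filterlim_bounded (V := R_NormedModule) u (ex_intro _ l Hu)) as [K HK].
exists K; exact HK.
Qed.

Lemma lipschitz1_step (f : nat -> R) :
  (forall k, Rabs (f (S k) - f k) <= 1) -> lipschitz1 f.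
Proof.
intros Hf.
assert (H : forall n x, Rabs (f (x + n)%nat - f x) <= INR n).
{ intros n x; induction n as [|n IH].
  - rewrite Nat.add_0_r, Rminus_diag, Rabs_R0; simpl; lra.
  - rewrite Nat.add_succ_r, S_INR.
    replace (f (S (x + n)) - f x)
      with (f (S (x + n)) - f (x + n)%nat + (f (x + n)%nat - f x)) by ring.
    eapply Rle_trans; [apply Rabs_triang|].
    generalize (Hf (x + n)%nat); lra. }
assert (H' : forall x y, (x <= y)%nat -> Rabs (f y - f x) <= Rabs (INR y - INR x)).
{ intros x y Hxy; rewrite <- minus_INR by exact Hxy.
  rewrite (Rabs_right (INR _)) by apply Rle_ge, pos_INR.
  replace y with (x + (y - x))%nat at 1 by lia; apply H. }
intros x y; destruct (Nat.le_ge_cases x y) as [Hxy|Hxy].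
- rewrite Rabs_minus_sym, (Rabs_minus_sym (INR x)); now apply H'.
- now apply H'.
Qed.

Lemma lipschitz1_step_le (f : nat -> R) (k : nat) :
  lipschitz1 f -> Rabs (f (S k) - f k) <= 1.
Proof.
intros Hf; generalize (Hf (S k) k); rewrite S_INR.
replace (INR k + 1 - INR k) with 1 by ring; now rewrite Rabs_R1.
Qed.

(** All but finitely many terms lie below [u n], so the maximum over a long enough initial segment
    is global. *)
Lemma max_attained_of_lim_0 (u : nat -> R) (n : nat) :
  is_lim_seq u 0 -> 0 < u n -> exists m, 0 < u m /\ forall j, u j <= u m.
Proof.
intros Hu Hn.
destruct (is_lim_seq_0_eventually u (u n) Hu Hn) as [N HN].
assert (H : forall M, exists m, forall j, (j <= M)%nat -> u j <= u m).
{ intros M; induction M as [|M [m Hm]].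
  - exists 0%nat; intros j Hj; replace j with 0%nat by lia; lra.
  - destruct (Rle_dec (u (S M)) (u m)) as [H|H].
    + exists m; intros j Hj; destruct (Nat.eq_dec j (S M)) as [->|Hne];
        [exact H | apply Hm; lia].
    + exists (S M); intros j Hj; destruct (Nat.eq_dec j (S M)) as [->|Hne];
        [lra | specialize (Hm j ltac:(lia)); lra]. }
destruct (H (Nat.max N n)) as [m Hm]; exists m.
assert (Hnm : u n <= u m) by (apply Hm; lia).
split; [lra|]; intros j.
destruct (Nat.le_gt_cases j (Nat.max N n)) as [Hj|Hj]; [now apply Hm|].
specialize (HN j ltac:(lia)); generalize (Rle_abs (u j)); lra.
Qed.

(* [killed_generator a b m u k] is, at the state [k + 1], the generator applied
   to [u] of the birth-death process with birth rate [a], death rate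
   [death_rate b k] and killing rate [m * (1 + 2 * b * k)]. *)
Definition killed_generator (a b m : R) (u : nat -> R) (k : nat) : R :=
  a * (u (S (S k)) - u (S k)) + death_rate b k * (u k - u (S k))
  - m * (1 + 2 * b * INR k) * u (S k).

(** The sign is opposite to [delta]: with it the differences up to third order of the solution for
    the identity are all nonpositive, and one maximum principle treats them all. *)
Definition backward_delta (u : nat -> R) (i : nat) : R := u i - u (S i).

(** The killing profile [1 + 2 * b * k] is the first difference of the death rates, so differencing
    adds one unit of killing; the slope [2 * b] of the profile leaves the last term. *)
Lemma killed_generator_backward_delta (a b m : R) (u : nat -> R) (k : nat) :
  killed_generator a b (m + 1) (backward_delta u) k =
  killed_generator a b m u k - killed_generator a b m u (S k)
  - 2 * b * m * u (S (S k)).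
Proof.
unfold killed_generator, backward_delta; rewrite death_rate_S, S_INR; ring.
Qed.

Lemma is_lim_seq_backward_delta (u : nat -> R) :
  is_lim_seq u 0 -> is_lim_seq (backward_delta u) 0.
Proof.
intros Hu; rewrite <- (Rminus_0_r 0); apply is_lim_seq_minus'; [exact Hu|].
now apply (is_lim_seq_incr_1 u).
Qed.

Lemma stein_eq_killed_generator (a b : R) (f g : nat -> R) (c : R) (k : nat) :
  stein_eq a b f g c -> killed_generator a b 1 g k = f (S k) - f k.
Proof.
intros Hg; generalize (Hg k) (Hg (S k)); unfold killed_generator.
rewrite death_rate_S; lra.
Qed.

Lemma stein_eq_first (a b : R) (f g : nat -> R) (c : R) :
  stein_eq a b f g c -> a * g 1%nat = f 0%nat - c.
Proof. intros Hg; generalize (Hg 0%nat); rewrite death_rate_0; lra. Qed.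

Lemma decaying_solution_lin (a b s t : R) (f1 f2 g1 g2 : nat -> R) (c1 c2 : R) :
  decaying_solution a b f1 g1 c1 -> decaying_solution a b f2 g2 c2 ->
  decaying_solution a b (fun x => s * f1 x + t * f2 x)
    (fun i => s * g1 i + t * g2 i) (s * c1 + t * c2).
Proof.
intros [H1 L1] [H2 L2]; split.
- intros i; generalize (H1 i) (H2 i); intros E1 E2.
  replace (s * f1 i + t * f2 i - (s * c1 + t * c2))
    with (s * (f1 i - c1) + t * (f2 i - c2)) by ring.
  rewrite <- E1, <- E2; ring.
- replace 0 with (s * 0 + t * 0) by ring.
  apply is_lim_seq_plus';
    apply (is_lim_seq_scal_l _ _ (Finite 0)); assumption.
Qed.

Lemma decaying_solution_shift (a b m : R) (f f' g : nat -> R) (c : R) :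
  (forall x, f' x = f x + m) ->
  decaying_solution a b f g c -> decaying_solution a b f' g (c + m).
Proof.
intros Hf [H L]; split; [|exact L].
intros i; rewrite H, Hf; ring.
Qed.

Section SteinEquation.

Context (a b : R) (ha : 0 < a) (hb : 0 < b).

Lemma death_rate_S_pos (k : nat) : 0 < death_rate b (S k).
Proof.
apply Rlt_le_trans with (INR (S k)); [apply lt_0_INR; lia|].
now apply death_rate_ge_INR.
Qed.

(** Maximum principle: at a positive maximum over the states from 1 on, the jump terms are
    nonpositive and the killing term is strictly negative. *)
Lemma killed_subsolution_nonpos (m : R) (u : nat -> R) :
  0 < m -> is_lim_seq u 0 -> (forall k, 0 <= killed_generator a b m u k) ->
  forall k, u (S k) <= 0.
Proof.
intros Hm Hu HL k; apply Rnot_lt_le; intros Hk.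
destruct (max_attained_of_lim_0 (fun j => u (S j)) k) as [i [Hi Hmax]];
  [now apply (is_lim_seq_incr_1 u) | exact Hk |].
specialize (HL i); unfold killed_generator in HL.
assert (H1 : a * (u (S (S i)) - u (S i)) <= 0)
  by (generalize (Hmax (S i)); nra).
assert (H2 : death_rate b i * (u i - u (S i)) <= 0).
(* At state 1 the term in [u 0], which is outside the range of the maximum, has coefficient
   [death_rate b 0 = 0]. *)
{ destruct i as [|i]; [rewrite death_rate_0; lra|].
  generalize (Hmax i) (death_rate_nonneg b hb (S i)); nra. }
assert (H3 : 0 <= b * INR i) by (apply Rmult_le_pos; [lra | apply pos_INR]).
assert (0 < m * (1 + 2 * b * INR i) * u (S i)).
{ apply Rmult_lt_0_compat; [|exact Hi]; apply Rmult_lt_0_compat; lra. }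
lra.
Qed.

(* Since the death rates are unbounded, a positive sequence satisfying this
   recursive inequality grows faster than geometrically. *)
Lemma bounded_supersolution_nonpos (u : nat -> R) (k : nat) (K : R) :
  (forall j, (S k <= j)%nat -> death_rate b j * u j <= a * u (S j)) ->
  (forall j, u j <= K) -> u (S k) <= 0.
Proof.
intros Hu HK; apply Rnot_lt_le; intros Hk.
assert (Hpos : forall n, 0 < u (S k + n)%nat).
{ intros n; induction n as [|n IH]; [now rewrite Nat.add_0_r|].
  rewrite Nat.add_succ_r; apply Rmult_lt_reg_l with a; [exact ha|].
  rewrite Rmult_0_r; eapply Rlt_le_trans; [|apply Hu; lia].
  apply Rmult_lt_0_compat; [apply (death_rate_S_pos (k + n)) | exact IH]. }
destruct (INR_unbounded (2 * a)) as [N HN].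
assert (Hdouble : forall n, 2 * u (S k + (N + n))%nat <= u (S k + S (N + n))%nat).
{ intros n; apply Rmult_le_reg_l with a; [exact ha|].
  rewrite Nat.add_succ_r; eapply Rle_trans; [|apply Hu; lia].
  replace (a * (2 * u (S k + (N + n))%nat))
    with (2 * a * u (S k + (N + n))%nat) by ring.
  apply Rmult_le_compat_r; [apply Rlt_le, Hpos|].
  apply Rle_trans with (INR (S k + (N + n))); [|now apply death_rate_ge_INR].
  apply Rle_trans with (INR N); [lra | apply le_INR; lia]. }
assert (Hgrow : forall n, INR (S n) * u (S k + N)%nat <= u (S k + (N + n))%nat).
{ intros n; induction n as [|n IH].
  - rewrite Nat.add_0_r; simpl; lra.
  - rewrite (Nat.add_succ_r N); eapply Rle_trans; [|apply Hdouble].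
    rewrite S_INR, S_INR in *.
    assert (0 <= INR n * u (S k + N)%nat)
      by (apply Rmult_le_pos; [apply pos_INR | apply Rlt_le, Hpos]).
    lra. }
specialize (Hpos N).
destruct (INR_unbounded (K / u (S k + N)%nat)) as [n Hn].
specialize (Hgrow n); specialize (HK (S k + (N + n))%nat).
apply Rlt_div_l in Hn; [|exact Hpos].
rewrite S_INR in Hgrow; lra.
Qed.

(** Were [c] negative, [bounded_supersolution_nonpos] would give [g 1 <= 0], against
    [a * g 1 = f 0 - c > 0]. An upper bound on [g] replaces decay because the quadratic test
    function used later has a solution that does not tend to 0. *)
Lemma stein_constant_nonneg (f g : nat -> R) (c K : R) :
  stein_eq a b f g c -> (forall n, g n <= K) -> (forall x, 0 <= f x) -> 0 <= c.
Proof.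
intros Hg HK Hf; apply Rnot_lt_le; intros Hc.
assert (H1 : g 1%nat <= 0).
{ apply bounded_supersolution_nonpos with K; [|exact HK].
  intros j _; generalize (Hg j) (Hf j); lra. }
generalize (stein_eq_first _ _ _ _ _ Hg) (Hf 0%nat); nra.
Qed.

Lemma decaying_solution_constant_nonneg (f g : nat -> R) (c : R) :
  decaying_solution a b f g c -> (forall x, 0 <= f x) -> 0 <= c.
Proof.
intros [Hg L]; destruct (is_lim_seq_bounded g 0 L) as [K HK].
apply stein_constant_nonneg with g K; [exact Hg|].
intros n; eapply Rle_trans; [apply Rle_abs | apply HK].
Qed.

Lemma decaying_homogeneous_zero (u : nat -> R) (k : nat) :
  is_lim_seq u 0 ->
  (forall j, (S k <= j)%nat -> a * u (S j) = death_rate b j * u j) ->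
  forall j, (S k <= j)%nat -> u j = 0.
Proof.
intros L Hu j Hj; destruct j as [|j]; [lia|].
destruct (is_lim_seq_bounded u 0 L) as [K HK].
apply Rle_antisym.
- apply bounded_supersolution_nonpos with K.
  + intros i Hi; rewrite Hu by lia; lra.
  + intros n; eapply Rle_trans; [apply Rle_abs | apply HK].
- apply Ropp_le_cancel; rewrite Ropp_0.
  apply (bounded_supersolution_nonpos (fun i => - u i)) with K.
  + intros i Hi; generalize (Hu i ltac:(lia)); lra.
  + intros n; eapply Rle_trans; [apply Rle_abs | rewrite Rabs_Ropp; apply HK].
Qed.

(** The difference solves the equation for the zero function. Its constant is nonnegative for either
    order of subtraction, hence zero, and the recursion propagates the value 0 from state 1. *)
Lemma decaying_solution_unique (f g1 g2 : nat -> R) (c1 c2 : R) :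
  decaying_solution a b f g1 c1 -> decaying_solution a b f g2 c2 ->
  forall k, g1 (S k) = g2 (S k).
Proof.
intros H1 H2 k.
assert (H := decaying_solution_lin a b 1 (-1) _ _ _ _ _ _ H1 H2).
assert (H' := decaying_solution_lin a b 1 (-1) _ _ _ _ _ _ H2 H1).
apply decaying_solution_constant_nonneg in H'; [|intros; lra].
assert (Hc := decaying_solution_constant_nonneg _ _ _ H ltac:(intros; lra)).
destruct H as [H L].
assert (Hz : 1 * g1 (S k) + -1 * g2 (S k) = 0); [|lra].
assert (Hfirst := stein_eq_first _ _ _ _ _ H).
assert (Hind : forall n, 1 * g1 (S n) + -1 * g2 (S n) = 0); [|apply Hind].
intros n; induction n as [|n IH].
- nra.
- generalize (H (S n)); rewrite IH; nra.
Qed.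

Lemma decaying_solution_nonpos (f g : nat -> R) (c : R) :
  decaying_solution a b f g c -> (forall k, f k <= f (S k)) ->
  forall k, g (S k) <= 0.
Proof.
intros [Hg L] Hf; apply killed_subsolution_nonpos with 1; [lra | exact L |].
intros k; rewrite (stein_eq_killed_generator _ _ _ _ _ _ Hg).
generalize (Hf k); lra.
Qed.

(** Differencing leaves the extra term [- 2 * b * g], which has the sign needed by the maximum
    principle because [g <= 0]. *)
Lemma decaying_solution_increasing (f g : nat -> R) (c : R) :
  decaying_solution a b f g c -> (forall k, f k <= f (S k)) ->
  (forall k, f (S (S k)) - f (S k) <= f (S k) - f k) ->
  forall k, backward_delta g (S k) <= 0.
Proof.
intros Hg Hf Hf2.
assert (Hneg := decaying_solution_nonpos _ _ _ Hg Hf); destruct Hg as [Hg L].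
apply killed_subsolution_nonpos with (1 + 1);
  [lra | now apply is_lim_seq_backward_delta |].
intros k; rewrite killed_generator_backward_delta.
rewrite !(stein_eq_killed_generator _ _ _ _ _ _ Hg).
generalize (Hf2 k) (Hneg (S k)); nra.
Qed.

(** Two differencings leave [- 6 * b] times the first backward difference, already known to be
    nonpositive. *)
Lemma decaying_solution_concave (f g : nat -> R) (c : R) :
  decaying_solution a b f g c -> (forall k, f k <= f (S k)) ->
  (forall k, f (S (S k)) - f (S k) <= f (S k) - f k) ->
  (forall k, 0 <= f (S (S (S k))) - 3 * f (S (S k)) + 3 * f (S k) - f k) ->
  forall k, backward_delta (backward_delta g) (S k) <= 0.
Proof.
intros Hg Hf Hf2 Hf3.
assert (Hinc := decaying_solution_increasing _ _ _ Hg Hf Hf2).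
destruct Hg as [Hg L].
apply killed_subsolution_nonpos with (1 + 1 + 1);
  [lra | now apply is_lim_seq_backward_delta, is_lim_seq_backward_delta |].
intros k; rewrite !killed_generator_backward_delta.
rewrite !(stein_eq_killed_generator _ _ _ _ _ _ Hg).
generalize (Hf3 k) (Hinc (S k)); unfold backward_delta; nra.
Qed.

(** This puts the extreme second difference of the solution at the first state. *)
Lemma identity_solution_third (g : nat -> R) (c : R) :
  decaying_solution a b INR g c ->
  forall k, backward_delta (backward_delta (backward_delta g)) (S k) <= 0.
Proof.
intros Hg.
assert (Hconc : forall k, backward_delta (backward_delta g) (S k) <= 0).
{ apply decaying_solution_concave with INR c; auto;
    intros k; rewrite !S_INR; lra. }
destruct Hg as [Hg L].
apply killed_subsolution_nonpos with (1 + 1 + 1 + 1);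
  [lra | now do 3 apply is_lim_seq_backward_delta |].
intros k; rewrite !killed_generator_backward_delta.
rewrite !(stein_eq_killed_generator _ _ _ _ _ _ Hg).
generalize (Hconc (S k)); unfold backward_delta; rewrite !S_INR; nra.
Qed.

(* The solution for a function vanishing up to [i] is, up to [i + 1], minus a
   nonnegative multiple of the expected upward passage times. *)
Lemma solution_before_support (f g : nat -> R) (c : R) (i : nat) :
  decaying_solution a b f g c -> (forall x, 0 <= f x) ->
  (forall j, (j <= i)%nat -> f j = 0) ->
  (forall j, (j <= i)%nat -> g (S j) <= 0) /\
  (forall j, (S j <= i)%nat -> 0 <= backward_delta g (S j)) /\
  (forall j, (S (S j) <= i)%nat ->
     backward_delta (backward_delta g) (S j) <= 0).
Proof.
intros Hg Hf H0.
assert (Hc := decaying_solution_constant_nonneg _ _ _ Hg Hf).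
destruct Hg as [Hg _].
assert (Hrec : forall j, (j <= i)%nat -> a * g (S j) = death_rate b j * g j - c).
{ intros j Hj; generalize (Hg j); rewrite (H0 j Hj); lra. }
assert (Hk : forall k, 0 <= 1 + 2 * b * INR k).
{ intros k; assert (0 <= b * INR k)
    by (apply Rmult_le_pos; [lra | apply pos_INR]); lra. }
assert (Hneg : forall j, (j <= i)%nat -> g (S j) <= 0).
{ intros j; induction j as [|j IH]; intros Hj; specialize (Hrec _ Hj).
  - rewrite death_rate_0 in Hrec; nra.
  - specialize (IH ltac:(lia)); generalize (death_rate_S_pos j); nra. }
assert (Hdelta : forall j, (S j <= i)%nat ->
  a * backward_delta g (S j) =
  death_rate b j * backward_delta g j - (1 + 2 * b * INR j) * g (S j)).
{ intros j Hj; generalize (Hrec j ltac:(lia)) (Hrec (S j) Hj).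
  unfold backward_delta; rewrite death_rate_S; lra. }
assert (Hinc : forall j, (S j <= i)%nat -> 0 <= backward_delta g (S j)).
{ intros j; induction j as [|j IH]; intros Hj; specialize (Hdelta _ Hj).
  - rewrite death_rate_0 in Hdelta; generalize (Hneg 0%nat ltac:(lia)).
    simpl in Hdelta; nra.
  - specialize (IH ltac:(lia)).
    generalize (death_rate_S_pos j) (Hneg (S j) ltac:(lia)) (Hk (S j)); nra. }
split; [exact Hneg | split; [exact Hinc|]].
assert (Hdelta2 : forall j, (S (S j) <= i)%nat ->
  a * backward_delta (backward_delta g) (S j) =
  death_rate b j * backward_delta (backward_delta g) j
  - 2 * (1 + 2 * b * INR j) * backward_delta g (S j) + 2 * b * g (S (S j))).
{ intros j Hj; generalize (Hdelta j ltac:(lia)) (Hdelta (S j) Hj).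
  unfold backward_delta; rewrite death_rate_S, S_INR; lra. }
intros j; induction j as [|j IH]; intros Hj; specialize (Hdelta2 _ Hj).
- rewrite death_rate_0 in Hdelta2; simpl in Hdelta2.
  generalize (Hinc 0%nat ltac:(lia)) (Hneg 1%nat ltac:(lia)); nra.
- specialize (IH ltac:(lia)).
  generalize (death_rate_S_pos j) (Hneg (S (S j)) ltac:(lia))
    (Hinc (S j) ltac:(lia)) (Hk (S j)); nra.
Qed.

End SteinEquation.

(** * Extremal Lipschitz functions *)

Definition step_above (i x : nat) : R := if Nat.leb x i then 0 else 1.

Lemma step_above_le (i x : nat) : (x <= i)%nat -> step_above i x = 0.
Proof. intros H; unfold step_above; now rewrite (proj2 (Nat.leb_le x i) H). Qed.

Lemma step_above_gt (i x : nat) : (i < x)%nat -> step_above i x = 1.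
Proof. intros H; unfold step_above; now rewrite (proj2 (Nat.leb_gt x i) H). Qed.

Lemma step_above_step (i k : nat) :
  step_above i (S k) - step_above i k = if Nat.eqb k i then 1 else 0.
Proof.
destruct (Nat.eqb_spec k i) as [->|H].
- rewrite (step_above_gt i (S i)), step_above_le by lia; ring.
- destruct (Nat.lt_ge_cases k i).
  + rewrite !step_above_le by lia; ring.
  + rewrite !step_above_gt by lia; ring.
Qed.

Section ExtremalFunctions.

Context (a b : R) (ha : 0 < a) (hb : 0 < b).

(* All solutions decaying from [i] on, where [f] vanishes, are proportional, so
   that [g] inherits its monotonicity and convexity from the solution [q]. *)
Lemma solution_after_support (f g q : nat -> R) (c cq : R) (i : nat) :
  decaying_solution a b (step_above 0) q cq ->
  decaying_solution a b f g c -> (forall x, 0 <= f x) ->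
  (forall j, (S i <= j)%nat -> f j = 0) ->
  0 <= backward_delta g (S i) /\ 0 <= backward_delta (backward_delta g) (S i).
Proof.
intros Hq Hg Hf H0.
assert (Hc := decaying_solution_constant_nonneg a b ha hb _ _ _ Hg Hf).
assert (Hstep : forall k, step_above 0 (S (S k)) - step_above 0 (S k) = 0)
  by (intros k; now rewrite step_above_step).
assert (Hstep0 : forall k, 0 <= step_above 0 (S k) - step_above 0 k)
  by (intros k; rewrite step_above_step; destruct (Nat.eqb k 0); lra).
assert (Hq2 := decaying_solution_increasing a b ha hb _ _ _ Hq
  ltac:(intros k; specialize (Hstep0 k); lra)
  ltac:(intros k; specialize (Hstep0 k); specialize (Hstep k); lra)).
assert (Hq3 := decaying_solution_concave a b ha hb _ _ _ Hq
  ltac:(intros k; specialize (Hstep0 k); lra)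
  ltac:(intros k; specialize (Hstep0 k); specialize (Hstep k); lra)
  ltac:(intros k; generalize (Hstep0 k) (Hstep k) (Hstep (S k)); lra)).
(* [cq] is the mass of the positive states. If it were at least 1, comparison for [- q] would give
   [q 1 >= 0], while [a * q 1 = - cq < 0]. *)
assert (Hcq : cq < 1).
{ apply Rnot_le_lt; intros Hge.
  destruct Hq as [Hq L]; destruct (is_lim_seq_bounded q 0 L) as [K HK].
  assert (- q 1%nat <= 0).
  { apply (bounded_supersolution_nonpos a b ha hb (fun j => - q j) 0 K).
    - intros j Hj; generalize (Hq j); rewrite step_above_gt by lia; lra.
    - intros j; eapply Rle_trans; [apply Rle_abs | rewrite Rabs_Ropp; apply HK]. }
  generalize (stein_eq_first _ _ _ _ _ Hq); rewrite step_above_le by lia; nra. }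
(* Beyond [i] the right-hand sides are [- c] and [1 - cq], so this combination solves the
   homogeneous equation. *)
assert (Heq : forall j, (S i <= j)%nat -> (1 - cq) * g j + c * q j = 0).
{ apply (decaying_homogeneous_zero a b ha hb (fun j => (1 - cq) * g j + c * q j)).
  - replace 0 with ((1 - cq) * 0 + c * 0) by ring.
    destruct Hq as [_ Lq], Hg as [_ Lg].
    apply is_lim_seq_plus';
      apply (is_lim_seq_scal_l _ _ (Finite 0)); assumption.
  - intros j Hj; generalize (proj1 Hq j) (proj1 Hg j).
    rewrite H0, step_above_gt by lia; intros E1 E2.
    replace (a * ((1 - cq) * g (S j) + c * q (S j)))
      with ((1 - cq) * (a * g (S j)) + c * (a * q (S j))) by ring.
    replace (a * g (S j)) with (death_rate b j * g j - c) by lra.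
    replace (a * q (S j)) with (death_rate b j * q j + 1 - cq) by lra.
    ring. }
assert (Hr : 0 <= c / (1 - cq)) by (apply Rle_div_r; lra).
assert (Hgq : forall j, (S i <= j)%nat -> g j = - (c / (1 - cq)) * q j).
{ intros j Hj; specialize (Heq j Hj).
  apply Rmult_eq_reg_l with (1 - cq); [|lra].
  replace ((1 - cq) * (- (c / (1 - cq)) * q j)) with (- (c * q j))
    by (field; lra).
  lra. }
specialize (Hq2 i); specialize (Hq3 i).
unfold backward_delta in *; rewrite !Hgq by lia; split; nra.
Qed.

(** Existence is supplied at the end by the given family of Stein solutions, so no auxiliary
    solution has to be constructed. *)
Context (Hex : forall f, lipschitz1 f ->
           exists g c, decaying_solution a b f g c).

Lemma exists_decaying_solution (f : nat -> R) (K : R) :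
  0 < K -> (forall k, Rabs (f (S k) - f k) <= K) ->
  exists g c, decaying_solution a b f g c.
Proof.
intros HK Hf.
destruct (Hex (fun x => / K * f x)) as [g [c Hg]].
- apply lipschitz1_step; intros k.
  rewrite <- Rmult_minus_distr_l, Rabs_mult, Rabs_right
    by (apply Rle_ge, Rlt_le, Rinv_0_lt_compat, HK).
  apply Rmult_le_reg_l with K; [exact HK|].
  rewrite <- Rmult_assoc, Rinv_r, Rmult_1_l, Rmult_1_r by lra; apply Hf.
(* Zero multiples fit a scaling into the two-term form of [decaying_solution_lin]. *)
- exists (fun i => K * g i + 0 * g i), (K * c + 0 * c + 0).
  apply decaying_solution_shift
    with (fun x => K * (/ K * f x) + 0 * (/ K * f x)).
  + intros x; field; lra.
  + now apply decaying_solution_lin.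
Qed.

Lemma exists_step_solution (i : nat) :
  exists q c, decaying_solution a b (step_above i) q c.
Proof.
apply exists_decaying_solution with 1; [lra|]; intros k.
rewrite step_above_step; destruct (Nat.eqb k i);
  rewrite ?Rabs_R0, ?Rabs_R1; lra.
Qed.

Lemma step_bound_max (f : nat -> R) (K : R) (i : nat) :
  0 < K -> (forall k, Rabs (f (S k) - f k) <= K) ->
  forall k, Rabs (f (Nat.max (S k) i) - f (Nat.max k i)) <= K.
Proof.
intros HK Hf k; destruct (Nat.lt_ge_cases k i).
- rewrite !Nat.max_r by lia; rewrite Rminus_diag, Rabs_R0; lra.
- rewrite !Nat.max_l by lia; apply Hf.
Qed.

Lemma step_bound_min (f : nat -> R) (K : R) (i : nat) :
  0 < K -> (forall k, Rabs (f (S k) - f k) <= K) ->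
  forall k, Rabs (f (Nat.min (S k) i) - f (Nat.min k i)) <= K.
Proof.
intros HK Hf k; destruct (Nat.lt_ge_cases k i).
- rewrite !Nat.min_l by lia; apply Hf.
- rewrite !Nat.min_r by lia; rewrite Rminus_diag, Rabs_R0; lra.
Qed.

(** Cut [f] at its zero [i + 1] into a part vanishing to the right and one vanishing to the left;
    [solution_after_support] and [solution_before_support] give both increments the same sign. *)
Lemma delta_nonpos_of_minimum (f g : nat -> R) (c K : R) (i : nat) :
  0 < K -> (forall k, Rabs (f (S k) - f k) <= K) ->
  decaying_solution a b f g c ->
  (forall x, 0 <= f x) -> f (S i) = 0 -> 0 <= backward_delta g (S i).
Proof.
intros HK HfK Hg Hf H0.
destruct (exists_step_solution 0) as [q [cq Hq]].
destruct (exists_decaying_solution (fun x => f (Nat.min x (S i))) K HK)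
  as [gl [cl Hl]]; [now apply step_bound_min|].
destruct (exists_decaying_solution (fun x => f (Nat.max x (S i))) K HK)
  as [gr [cr Hr]]; [now apply step_bound_max|].
destruct (solution_after_support _ _ _ _ _ i Hq Hl) as [Hdl _];
  [intros; apply Hf | intros; now rewrite Nat.min_r by lia |].
destruct (solution_before_support a b ha hb _ _ _ (S i) Hr) as [_ [Hdr _]];
  [intros; apply Hf | intros; now rewrite Nat.max_r by lia |].
specialize (Hdr i ltac:(lia)).
assert (Hs := decaying_solution_lin a b 1 1 _ _ _ _ _ _ Hl Hr).
apply (decaying_solution_shift _ _ 0 _ f) in Hs.
- assert (Hu := decaying_solution_unique a b ha hb _ _ _ _ _ Hg Hs).
  unfold backward_delta in *; rewrite !Hu; lra.
- intros x; destruct (Nat.le_ge_cases x (S i)).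
  + rewrite Nat.min_l, Nat.max_r, H0 by lia; ring.
  + rewrite Nat.min_r, Nat.max_l, H0 by lia; ring.
Qed.

(** The flat step lets [f - f (i + 1)] be cut into a nonpositive part supported up to [i] and a
    nonnegative part supported from [i + 3] on. *)
Lemma delta2_nonpos_of_flat_monotone (f g : nat -> R) (c K : R) (i : nat) :
  0 < K -> (forall k, Rabs (f (S k) - f k) <= K) ->
  decaying_solution a b f g c ->
  (forall k, f k <= f (S k)) -> f (S (S i)) = f (S i) ->
  backward_delta (backward_delta g) (S i) <= 0.
Proof.
intros HK HfK Hg Hf H0.
assert (Hmono : forall x y, (x <= y)%nat -> f x <= f y).
{ intros x y Hxy; induction Hxy as [|y Hxy IH]; [lra|].
  generalize (Hf y); lra. }
destruct (exists_step_solution 0) as [q [cq Hq]].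
destruct (exists_decaying_solution (fun x => f (Nat.min x (S i))) K HK)
  as [gl [cl Hl]]; [now apply step_bound_min|].
destruct (exists_decaying_solution (fun x => f (Nat.max x (S (S i)))) K HK)
  as [gr [cr Hr]]; [now apply step_bound_max|].
assert (Hl' := decaying_solution_lin a b (-1) 0 _ _ _ _ _ _ Hl Hl).
apply (decaying_solution_shift _ _ (f (S i)) _
         (fun x => f (S i) - f (Nat.min x (S i)))) in Hl'; [|intros; ring].
apply (decaying_solution_shift _ _ (- f (S i)) _
         (fun x => f (Nat.max x (S (S i))) - f (S i))) in Hr; [|intros; ring].
destruct (solution_after_support _ _ _ _ _ i Hq Hl') as [_ Hdl].
{ intros x; generalize (Hmono (Nat.min x (S i)) (S i) ltac:(lia)); lra. }
{ intros j Hj; rewrite Nat.min_r by lia; ring. }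
destruct (solution_before_support a b ha hb _ _ _ (S (S i)) Hr)
  as [_ [_ Hdr]].
{ intros x; generalize (Hmono (S i) (Nat.max x (S (S i))) ltac:(lia)); lra. }
{ intros j Hj; rewrite Nat.max_r, H0 by lia; ring. }
specialize (Hdr i ltac:(lia)).
assert (Hs := decaying_solution_lin a b 1 1 _ _ _ _ _ _ Hl Hr).
apply (decaying_solution_shift _ _ 0 _ f) in Hs.
- assert (Hu := decaying_solution_unique a b ha hb _ _ _ _ _ Hg Hs).
  unfold backward_delta in *; rewrite !Hu; lra.
- intros x; destruct (Nat.le_gt_cases x (S i)).
  + rewrite Nat.min_l, Nat.max_r, H0 by lia; ring.
  + rewrite Nat.min_r, Nat.max_l by lia; ring.
Qed.

Lemma positive_part_step (i k : nat) :
  INR (S k - i) - INR (k - i) = if Nat.leb i k then 1 else 0.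
Proof.
destruct (Nat.leb_spec i k).
- rewrite Nat.sub_succ_l, S_INR by lia; ring.
- replace (S k - i)%nat with 0%nat by lia.
  replace (k - i)%nat with 0%nat by lia; ring.
Qed.

(* With [f x = max (x - (i + 1)) 0], the second difference of [f] is a point mass,
   so the maximum principle puts the largest increment of [- g] there. *)
Lemma positive_part_solution (g : nat -> R) (c : R) (i : nat) :
  decaying_solution a b (fun x => INR (x - S i)) g c ->
  0 <= backward_delta g (S i) /\ g (S i) <= 0 /\
  (a - death_rate b i) * backward_delta g (S i)
    <= - (1 + 2 * b * INR i) * g (S i) /\
  2 * (1 + 2 * b * INR i) * backward_delta g (S i)
    + 2 * b * (backward_delta g (S i) - g (S i)) <= 1.
Proof.
intros Hg.
assert (Hneg : forall k, g (S k) <= 0).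
{ apply (decaying_solution_nonpos a b ha hb _ _ _ Hg); intros k.
  generalize (positive_part_step (S i) k); destruct (Nat.leb (S i) k); lra. }
destruct (solution_before_support a b ha hb _ _ _ (S i) Hg) as [_ [Hinc _]].
{ intros; apply pos_INR. }
{ intros j Hj; now replace (j - S i)%nat with 0%nat by lia. }
assert (HD := Hinc i ltac:(lia)).
assert (L := is_lim_seq_backward_delta _ (proj2 Hg)).
destruct Hg as [Hg _].
assert (HL : forall k, killed_generator a b (1 + 1) (backward_delta g) k =
  - (if Nat.eqb k i then 1 else 0) - 2 * b * g (S (S k))).
{ intros k; rewrite killed_generator_backward_delta.
  rewrite !(stein_eq_killed_generator _ _ _ _ _ _ Hg), !positive_part_step.
  destruct (Nat.leb_spec (S i) (S k)), (Nat.leb_spec (S i) k), (Nat.eqb_spec k i);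
    try lia; ring. }
assert (Hk : forall k, 0 <= b * INR k)
  by (intros k; apply Rmult_le_pos; [lra | apply pos_INR]).
assert (Hmax : forall j, backward_delta g (S j) <= backward_delta g (S i)).
{ intros j; apply Rnot_lt_le; intros Hj.
  destruct (max_attained_of_lim_0 (fun n => backward_delta g (S n)) j)
    as [n [Hn Hmax]]; [now apply (is_lim_seq_incr_1 (backward_delta g)) | lra |].
  assert (Hni : n <> i) by (intros ->; specialize (Hmax j); lra).
  generalize (HL n); rewrite (proj2 (Nat.eqb_neq n i) Hni).
  unfold killed_generator.
  assert (H1 : a * (backward_delta g (S (S n)) - backward_delta g (S n)) <= 0)
    by (generalize (Hmax (S n)); nra).
  assert (H2 : death_rate b n * (backward_delta g n - backward_delta g (S n)) <= 0).
  { destruct n as [|n]; [rewrite death_rate_0; lra|].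
    generalize (Hmax n) (death_rate_nonneg b hb (S n)); nra. }
  assert (0 < (1 + 1) * (1 + 2 * b * INR n) * backward_delta g (S n)).
  { apply Rmult_lt_0_compat; [|exact Hn]; specialize (Hk n); lra. }
  generalize (Hneg (S n)); nra. }
assert (H2 : death_rate b i * (backward_delta g i - backward_delta g (S i)) <= 0).
{ destruct i as [|i]; [rewrite death_rate_0; lra|].
  generalize (Hmax i) (death_rate_nonneg b hb (S i)); nra. }
split; [exact HD | split; [apply Hneg | split]].
- generalize (Hg i) (Hg (S i)).
  replace (i - S i)%nat with 0%nat by lia; rewrite Nat.sub_diag; simpl (INR 0).
  rewrite death_rate_S; unfold backward_delta in *; lra.
- generalize (HL i); rewrite Nat.eqb_refl; unfold killed_generator.
  assert (H1 : a * (backward_delta g (S (S i)) - backward_delta g (S i)) <= 0)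
    by (generalize (Hmax (S i)); nra).
  replace (g (S (S i))) with (g (S i) - backward_delta g (S i))
    by (unfold backward_delta; ring).
  lra.
Qed.

(** The first bound drops nonnegative terms from the last inequality of [positive_part_solution];
    the second eliminates [g (S i)] between its last two inequalities. *)
Lemma positive_part_delta_le (g : nat -> R) (c : R) (i : nat) :
  decaying_solution a b (fun x => INR (x - S i)) g c ->
  backward_delta g (S i) <= 1 / (2 * (1 + b)) /\
  backward_delta g (S i) <= 1 / (2 * sqrt (a * b)).
Proof.
intros Hg; destruct (positive_part_solution g c i Hg) as [HD [Hp [Hlow Hup]]].
assert (Hk : 0 <= b * INR i) by (apply Rmult_le_pos; [lra | apply pos_INR]).
assert (Hab : 0 < a * b) by now apply Rmult_lt_0_compat.
assert (Hr := sqrt_lt_R0 _ Hab); assert (Hr2 := sqrt_sqrt _ (Rlt_le _ _ Hab)).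
set (D := backward_delta g (S i)) in *; set (p := - g (S i)).
set (r := sqrt (a * b)) in *.
split; apply Rle_div_r; try lra.
- assert (0 <= b * p) by (unfold p; nra); unfold p in *.
  assert (0 <= b * INR i * D) by nra.
  lra.
- set (s := b * INR i) in *.
  assert (Hbeta : b * death_rate b i = s * (1 + s) - b * s)
    by (unfold s, death_rate; ring).
  set (kappa := 1 + 2 * s).
  assert (Hlow' : b * (a - death_rate b i) * D <= kappa * (b * p)).
  { generalize (Rmult_le_compat_l b _ _ (Rlt_le _ _ hb) Hlow).
    unfold kappa, p, s; lra. }
  assert (Hup' : 2 * kappa * D + 2 * b * D + 2 * (b * p) <= 1)
    by (unfold kappa, p, s; lra).
  (* AM-GM, using [b * death_rate b i <= s * (1 + s)]. *)
  assert (Hq : kappa * r <= kappa * kappa + b * kappa + (r * r - b * death_rate b i)).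
  { rewrite Hbeta; unfold kappa.
    generalize (Rle_0_sqr (r - (1 + 2 * s) / 2)); unfold Rsqr.
    assert (0 <= b * (1 + 2 * s)) by nra.
    assert (0 <= b * s) by nra.
    nra. }
  assert (Hkap : 0 < kappa) by (unfold kappa; lra).
  apply Rmult_le_reg_l with kappa; [exact Hkap|].
  assert (kappa * r * D
    <= (kappa * kappa + b * kappa + (r * r - b * death_rate b i)) * D) by nra.
  assert (r * r * D - b * death_rate b i * D <= kappa * (b * p)) by nra.
  nra.
Qed.

End ExtremalFunctions.

(** * The solution for the identity function *)

Section IdentitySolution.

Context (a b : R) (ha : 0 < a) (hb : 0 < b) (h : nat -> R) (mu : R)
  (Hh : decaying_solution a b INR h mu).

Lemma identity_solution_nonpos (k : nat) : h (S k) <= 0.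
Proof.
apply (decaying_solution_nonpos a b ha hb _ _ _ Hh).
intros j; rewrite S_INR; lra.
Qed.

Lemma identity_solution_increasing (k : nat) : h (S k) <= h (S (S k)).
Proof.
apply Rminus_le, (decaying_solution_increasing a b ha hb _ _ _ Hh);
  intros j; rewrite !S_INR; lra.
Qed.

Lemma identity_solution_increment (k : nat) :
  h (S (S k)) - h (S k) <= h 2%nat - h 1%nat.
Proof.
induction k as [|k IH]; [lra|].
assert (H := decaying_solution_concave a b ha hb _ _ _ Hh).
specialize (H ltac:(intros j; rewrite !S_INR; lra)
  ltac:(intros j; rewrite !S_INR; lra) ltac:(intros j; rewrite !S_INR; lra) k).
unfold backward_delta in H; lra.
Qed.

Lemma identity_solution_second_increment (k : nat) :
  - backward_delta (backward_delta h) (S k)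
  <= - backward_delta (backward_delta h) 1.
Proof.
induction k as [|k IH]; [lra|].
generalize (identity_solution_third a b ha hb _ _ Hh k).
unfold backward_delta at 1; lra.
Qed.

Lemma identity_solution_values :
  mu = - a * h 1%nat /\ a * h 2%nat = 1 + (1 + a) * h 1%nat /\
  a * h 3%nat = (2 + 2 * b) * h 2%nat + 2 + a * h 1%nat.
Proof.
destruct Hh as [H _]; generalize (H 0%nat) (H 1%nat) (H 2%nat).
rewrite !death_rate_S, death_rate_0; simpl; intros; repeat split; lra.
Qed.

(* Monotonicity of [h] between 2 and 3, written in terms of [h 1]. *)
Lemma identity_solution_first_upper :
  - h 1%nat * (a + 2 * b + 2 + 2 * a * b) <= a + 2 * b + 2.
Proof.
destruct identity_solution_values as [_ [E2 E3]].
generalize (identity_solution_increasing 1); intros H.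
apply (Rmult_le_compat_l (a * a)) in H; [|nra].
replace (a * a * h 3%nat) with (a * (a * h 3%nat)) in H by ring.
rewrite E3 in H.
replace (a * ((2 + 2 * b) * h 2%nat + 2 + a * h 1%nat))
  with ((2 + 2 * b) * (a * h 2%nat) + a * (2 + a * h 1%nat)) in H by ring.
replace (a * a * h 2%nat) with (a * (a * h 2%nat)) in H by ring.
rewrite E2 in H; lra.
Qed.

(* [h 3 <= 0] says that the mean dominates the mean conditioned to {0, 1, 2}. *)
Lemma identity_solution_first_lower :
  2 + 2 * b + 2 * a <= - h 1%nat * (a ^ 2 + 2 * a + 2 + 2 * b * (a + 1)).
Proof.
destruct identity_solution_values as [_ [E2 E3]].
generalize (identity_solution_nonpos 2); intros H.
apply (Rmult_le_compat_l (a * a)) in H; [|nra].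
replace (a * a * h 3%nat) with (a * (a * h 3%nat)) in H by ring.
rewrite E3 in H.
replace (a * ((2 + 2 * b) * h 2%nat + 2 + a * h 1%nat))
  with ((2 + 2 * b) * (a * h 2%nat) + a * (2 + a * h 1%nat)) in H by ring.
rewrite E2 in H; lra.
Qed.

Lemma identity_solution_bound_1 :
  - h 1%nat <= 1 / (1 + 2 * a * b / (a + 2 * b + 2)).
Proof.
assert (Hab : 0 < a * b) by now apply Rmult_lt_0_compat.
replace (1 / (1 + 2 * a * b / (a + 2 * b + 2)))
  with ((a + 2 * b + 2) / (a + 2 * b + 2 + 2 * a * b)) by (field; lra).
apply Rle_div_r; [lra | exact identity_solution_first_upper].
Qed.

(* Since [death_rate b] is quadratic, a constant sequence plus a multiple of [h]
   solves the equation for [b * (x - mu)^2]; its mean is nonnegative. *)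
Lemma identity_solution_quadratic :
  a * b * (h 1%nat * h 1%nat) + (1 - b) * - h 1%nat <= 1.
Proof.
assert (Hmu := proj1 identity_solution_values).
(* The constant is [b] times the variance, as the mean of the death rates is the birth rate [a]. *)
assert (0 <= a - (1 - b) * mu - b * mu * mu).
{ destruct (is_lim_seq_bounded h 0 (proj2 Hh)) as [K HK].
  apply (stein_constant_nonneg a b ha hb
    (fun x => b * (INR x - mu) * (INR x - mu))
    (fun i => - 1 - (1 - b + 2 * b * mu) * h i) _
    (Rabs (1 - b + 2 * b * mu) * K)).
  - intros i; generalize (proj1 Hh i); intros E.
    replace (a * (- 1 - (1 - b + 2 * b * mu) * h (S i))
      - death_rate b i * (- 1 - (1 - b + 2 * b * mu) * h i))
      with (death_rate b i - a
            - (1 - b + 2 * b * mu) * (a * h (S i) - death_rate b i * h i))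
      by ring.
    rewrite E; unfold death_rate; ring.
  - intros n.
    assert (Rabs ((1 - b + 2 * b * mu) * h n) <= Rabs (1 - b + 2 * b * mu) * K)
      by (rewrite Rabs_mult; apply Rmult_le_compat_l; [apply Rabs_pos | apply HK]).
    generalize (Rabs_maj2 ((1 - b + 2 * b * mu) * h n)); lra.
  - intros x; generalize (Rle_0_sqr (INR x - mu)); unfold Rsqr; nra. }
rewrite Hmu in H.
apply Rmult_le_reg_l with a; [exact ha|]; lra.
Qed.

Lemma identity_solution_bound_2 :
  - h 1%nat <= (sqrt (a * b + (b - 1) ^ 2 / 4) + (b - 1) / 2) / (a * b).
Proof.
assert (Hab : 0 < a * b) by now apply Rmult_lt_0_compat.
assert (Hq := identity_solution_quadratic).
apply Rle_div_r; [exact Hab|].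
(* Completing the square in [Hq] bounds the square of [y] by the radicand. *)
set (y := - h 1%nat * (a * b) - (b - 1) / 2).
assert (Hy : y <= sqrt (a * b + (b - 1) ^ 2 / 4)).
{ eapply Rle_trans; [apply Rle_abs|].
  rewrite <- sqrt_Rsqr_abs; apply sqrt_le_1_alt; unfold Rsqr, y.
  apply (Rmult_le_compat_l (a * b)) in Hq; [nra | lra]. }
unfold y in Hy; lra.
Qed.

(** By the equation, [a * (h 2 - h 1) = 1 + h 1], so the lower bound on [- h 1] applies. *)
Lemma identity_solution_increment_1 :
  h 2%nat - h 1%nat <= (a + 2 * b) / (a ^ 2 + 2 * a + 2 + 2 * b * (a + 1)).
Proof.
destruct identity_solution_values as [_ [E2 _]].
assert (Hl := identity_solution_first_lower).
assert (Hab : 0 < a * b) by now apply Rmult_lt_0_compat.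
apply Rle_div_r; [nra|].
apply Rmult_le_reg_l with a; [exact ha|].
replace (a * ((h 2%nat - h 1%nat) * (a ^ 2 + 2 * a + 2 + 2 * b * (a + 1))))
  with ((a * h 2%nat - a * h 1%nat) * (a ^ 2 + 2 * a + 2 + 2 * b * (a + 1)))
  by ring.
rewrite E2; lra.
Qed.

Lemma identity_solution_increment_2 : h 2%nat - h 1%nat <= 1 / a.
Proof.
destruct identity_solution_values as [_ [E2 _]].
apply Rle_div_r; [exact ha|].
generalize (identity_solution_nonpos 0); lra.
Qed.

Lemma identity_solution_first_le : - h 1%nat <= 1.
Proof.
assert (Hu := identity_solution_first_upper).
assert (Hab : 0 < a * b) by now apply Rmult_lt_0_compat.
nra.
Qed.

Lemma identity_solution_second_increment_1 :
  - backward_delta (backward_delta h) 1 <= b / ((a + 1) * b + 1 + a / 2).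
Proof.
destruct identity_solution_values as [_ [E2 E3]].
assert (Hu := identity_solution_first_upper).
assert (Hab : 0 < a * b) by now apply Rmult_lt_0_compat.
apply Rle_div_r; [lra|].
apply Rmult_le_reg_l with (2 * (a * a)); [nra|].
(* [M] is twice the denominator of the claim, and [Hu] reads [- h 1 * M <= M - 2 * a * b]. *)
set (M := a + 2 * b + 2 + 2 * a * b) in *.
assert (E : a * a * - backward_delta (backward_delta h) 1
            = - (2 + 2 * b) - (M - a) * h 1%nat).
{ unfold backward_delta.
  replace (a * a * - (h 1%nat - h 2%nat - (h 2%nat - h 3%nat)))
    with (2 * a * (a * h 2%nat) - a * a * h 1%nat - a * (a * h 3%nat)) by ring.
  rewrite E3.
  replace (a * ((2 + 2 * b) * h 2%nat + 2 + a * h 1%nat))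
    with ((2 + 2 * b) * (a * h 2%nat) + a * (2 + a * h 1%nat)) by ring.
  rewrite E2; unfold M; ring. }
replace (2 * (a * a) * (- backward_delta (backward_delta h) 1
                        * ((a + 1) * b + 1 + a / 2)))
  with (a * a * - backward_delta (backward_delta h) 1 * M)
  by (unfold M; field).
rewrite E.
apply (Rmult_le_compat_l (M - a)) in Hu; [|unfold M; lra].
replace ((- (2 + 2 * b) - (M - a) * h 1%nat) * M)
  with ((M - a) * (- h 1%nat * M) - (2 + 2 * b) * M) by ring.
unfold M in *; nra.
Qed.

End IdentitySolution.

(** * Unit steps and arbitrary Lipschitz functions *)

(** In the differenced equation at state [i + 1] the jump contributes 1, and every term other than
    [a] times the second difference has a favourable sign before the support. *)
Lemma step_solution_second_difference (a b : R) (ha : 0 < a) (hb : 0 < b)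
    (q : nat -> R) (c : R) (i : nat) :
  decaying_solution a b (step_above (S i)) q c ->
  backward_delta (backward_delta q) (S i) <= 1 / a.
Proof.
intros Hq.
destruct (solution_before_support a b ha hb _ _ _ (S i) Hq) as [H1 [H2 H3]].
{ intros x; unfold step_above; destruct (Nat.leb x (S i)); lra. }
{ intros; now apply step_above_le. }
generalize (killed_generator_backward_delta a b 1 q i).
rewrite !(stein_eq_killed_generator _ _ _ _ _ _ (proj1 Hq)), !step_above_step.
rewrite Nat.eqb_refl, (proj2 (Nat.eqb_neq i (S i))) by lia.
unfold killed_generator; intros E.
assert (Hb2 : death_rate b i * backward_delta (backward_delta q) i <= 0).
{ destruct i as [|i]; [rewrite death_rate_0; lra|].
  generalize (H3 i ltac:(lia)) (death_rate_nonneg b hb (S i)); nra. }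
specialize (H1 (S i) ltac:(lia)); specialize (H2 i ltac:(lia)).
assert (Hk : 0 <= b * INR i) by (apply Rmult_le_pos; [lra | apply pos_INR]).
assert (0 <= (1 + 1) * (1 + 2 * b * INR i) * backward_delta q (S i)) by nra.
assert (b * q (S (S i)) <= 0) by nra.
apply Rle_div_r; [exact ha|].
unfold backward_delta at 1; unfold backward_delta at 1 in Hb2; lra.
Qed.

Section LipschitzSolutions.

Context (a b : R) (ha : 0 < a) (hb : 0 < b).
Context (Hex : forall f, lipschitz1 f ->
           exists g c, decaying_solution a b f g c).
Context (h : nat -> R) (mu : R) (Hh : decaying_solution a b INR h mu).
Context (f g : nat -> R) (c : R) (Hf : lipschitz1 f)
  (Hg : decaying_solution a b f g c).

(** Both [x + f x] and [x - f x] are nondecreasing, so [h + g] and [h - g] are nonpositive; moreover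
    [h] is smallest at 1. *)
Lemma lipschitz_solution_le (k : nat) : Rabs (g (S k)) <= - h 1%nat.
Proof.
assert (Hs : forall s, s = 1 \/ s = - 1 -> h (S k) + s * g (S k) <= 0).
{ intros s Hs.
  assert (H := decaying_solution_lin a b 1 s _ _ _ _ _ _ Hh Hg).
  apply (decaying_solution_nonpos a b ha hb) with (k := k) in H.
  { lra. }
  intros j; rewrite S_INR; generalize (lipschitz1_step_le f j Hf); intros Hj.
  apply Rabs_le_between in Hj; destruct Hs; subst s; lra. }
assert (Hmono : forall n, h 1%nat <= h (S n)).
{ intros n; induction n as [|n IH]; [lra|].
  generalize (identity_solution_increasing a b ha hb h mu Hh n); lra. }
generalize (Hmono k) (Hs 1 (or_introl eq_refl)) (Hs (-1) (or_intror eq_refl)).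
intros; apply Rabs_le; lra.
Qed.

(* Among the Lipschitz functions, [fun x => |x - (k + 1)|] has the extremal
   difference at [k + 1]; it is [2 * max (x - (k + 1)) 0 - x] up to a constant. *)
Lemma lipschitz_solution_delta_le (p : nat -> R) (cp : R) (k : nat) :
  decaying_solution a b (fun x => INR (x - S k)) p cp ->
  Rabs (backward_delta g (S k))
    <= 2 * backward_delta p (S k) + (h 2%nat - h 1%nat).
Proof.
intros Hp.
assert (Hs : forall s, s = 1 \/ s = - 1 ->
  0 <= 2 * backward_delta p (S k) - backward_delta h (S k)
       + s * backward_delta g (S k)).
{ intros s Hs.
  assert (H := decaying_solution_lin a b 1 s _ _ _ _ _ _
    (decaying_solution_lin a b 2 (-1) _ _ _ _ _ _ Hp Hh) Hg).
  (* The shift makes the function [|x - (k + 1)|] plus or minus [f x - f (k + 1)], nonnegative by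
     the Lipschitz property and zero at [k + 1]. *)
  apply (decaying_solution_shift _ _ (INR (S k) - s * f (S k)) _
    (fun x => 2 * INR (x - S k) - INR x + INR (S k) + s * (f x - f (S k)))) in H;
    [|intros; ring].
  apply (delta_nonpos_of_minimum a b ha hb Hex _ _ _ 2 k) in H.
  - unfold backward_delta in *; lra.
  - lra.
  - intros j; generalize (positive_part_step (S k) j).
    generalize (lipschitz1_step_le f j Hf); intros Hj.
    apply Rabs_le_between in Hj; rewrite S_INR.
    intros; apply Rabs_le; destruct Hs; subst s; destruct (Nat.leb (S k) j); lra.
  - intros x; generalize (Hf x (S k)); intros Hx.
    destruct (Nat.le_ge_cases x (S k)) as [Hxk|Hxk].
    + replace (x - S k)%nat with 0%nat by lia.
      apply le_INR in Hxk; rewrite (Rabs_left1 (INR x - INR (S k))) in Hx by lra.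
      apply Rabs_le_between in Hx; simpl (INR 0); destruct Hs; subst s; lra.
    + rewrite minus_INR by exact Hxk.
      apply le_INR in Hxk; rewrite (Rabs_right (INR x - INR (S k))) in Hx by lra.
      apply Rabs_le_between in Hx; destruct Hs; subst s; lra.
  - rewrite Nat.sub_diag; simpl (INR 0); ring. }
generalize (Hs 1 (or_introl eq_refl)) (Hs (-1) (or_intror eq_refl)).
generalize (identity_solution_increment a b ha hb h mu Hh k).
unfold backward_delta; intros; apply Rabs_le; lra.
Qed.

(* Once the jump [t] of [f] between [k + 1] and [k + 2] is split off, the extremal
   function is [x] minus the unit step there. *)
Lemma lipschitz_solution_delta2_le (k : nat) :
  Rabs (backward_delta (backward_delta g) (S k))
    <= 2 / a + b / ((a + 1) * b + 1 + a / 2).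
Proof.
destruct (exists_step_solution a b Hex (S k)) as [q [cq Hq]].
assert (Hx := step_solution_second_difference a b ha hb q cq k Hq).
set (x := backward_delta (backward_delta q) (S k)) in *.
set (t := f (S (S k)) - f (S k)).
assert (Ht : Rabs t <= 1) by now apply lipschitz1_step_le.
(* The combination belongs to a function whose step at [k + 1] is 0 and whose other steps
   [1 + s * (f (S j) - f j)] are nonnegative, so [delta2_nonpos_of_flat_monotone] applies. *)
assert (Hs : forall s, s = 1 \/ s = - 1 ->
  backward_delta (backward_delta h) (S k) - x
  + s * (backward_delta (backward_delta g) (S k) - t * x) <= 0).
{ intros s Hs.
  assert (H := decaying_solution_lin a b 1 s _ _ _ _ _ _
    (decaying_solution_lin a b 1 (-1) _ _ _ _ _ _ Hh Hq)
    (decaying_solution_lin a b 1 (-t) _ _ _ _ _ _ Hg Hq)).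
  assert (Hstep : forall j,
    1 * (1 * INR (S j) + -1 * step_above (S k) (S j))
    + s * (1 * f (S j) + - t * step_above (S k) (S j))
    - (1 * (1 * INR j + -1 * step_above (S k) j)
       + s * (1 * f j + - t * step_above (S k) j))
    = if Nat.eqb j (S k) then 0 else 1 + s * (f (S j) - f j)).
  { intros j; generalize (step_above_step (S k) j).
    destruct (Nat.eqb_spec j (S k)) as [->|Hj]; rewrite S_INR; intros E.
    - replace (step_above (S k) (S (S k)))
        with (1 + step_above (S k) (S k)) by lra.
      unfold t; ring.
    - replace (step_above (S k) (S j)) with (step_above (S k) j) by lra; ring. }
  assert (Hstep' : forall j, 0 <= 1 + s * (f (S j) - f j) <= 2).
  { intros j; generalize (lipschitz1_step_le f j Hf); intros Hj.
    apply Rabs_le_between in Hj; destruct Hs; subst s; lra. }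
  apply (delta2_nonpos_of_flat_monotone a b ha hb Hex _ _ _ 2 k) in H.
  - unfold x; unfold backward_delta in *; lra.
  - lra.
  - intros j; rewrite Hstep; destruct (Nat.eqb j (S k)); apply Rabs_le;
      [lra | specialize (Hstep' j); lra].
  - intros j; apply Rminus_le_0; rewrite Hstep.
    destruct (Nat.eqb j (S k)); [lra | apply Hstep'].
  - apply Rminus_diag_uniq; now rewrite Hstep, Nat.eqb_refl. }
generalize (Hs 1 (or_introl eq_refl)) (Hs (-1) (or_intror eq_refl)).
generalize (identity_solution_second_increment a b ha hb h mu Hh k).
generalize (identity_solution_second_increment_1 a b ha hb h mu Hh).
set (B := b / ((a + 1) * b + 1 + a / 2)).
(* Since [|t| <= 1], the sum [x + |t * x|] is at most 0 for negative [x] and at most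
   [2 * x <= 2 / a] otherwise. *)
assert (Htx : Rabs (t * x) <= Rabs x)
  by (rewrite Rabs_mult; generalize (Rabs_pos x); nra).
apply Rabs_le_between in Htx.
assert (Ha : 2 / a = 2 * (1 / a)) by (field; lra).
assert (0 < 1 / a) by (apply Rdiv_lt_0_compat; lra).
intros; apply Rabs_le; revert Htx; unfold Rabs; destruct (Rcase_abs x); lra.
Qed.

End LipschitzSolutions.

(** * From pointwise bounds to suprema *)

Lemma sup_lipschitz1_le (N : (nat -> R) -> nat -> R) (M : R) :
  (forall f, lipschitz1 f -> forall i, Rabs (N f i) <= M) ->
  Rbar_le (sup_lipschitz1 (fun f => sup_norm (N f))) M.
Proof.
intros H; unfold sup_lipschitz1, Rbar_lub.
destruct (Rbar_ex_lub _) as [l [Hu Hl]]; cbn [proj1_sig]; apply Hl.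
intros y [f [Hf ->]].
apply (is_sup_seq_lub _ _ (Sup_seq_correct _)).
intros z [n ->]; apply H, Hf.
Qed.

Theorem corollary1p2 (a b : R) (ha : 0 < a) (hb : 0 < b)
    (g : (nat -> R) -> nat -> R)
    (hg : forall f : nat -> R, lipschitz1 f -> stein_solution a b f (g f)) :
  Rbar_le (sup_lipschitz1 (fun f => sup_norm (g f)))
    (Rmin (1 / (1 + 2 * a * b / (a + 2 * b + 2)))
          ((sqrt (a * b + (b - 1) ^ 2 / 4) + (b - 1) / 2) / (a * b))) /\
  Rbar_le (sup_lipschitz1 (fun f => sup_norm (delta (g f))))
    (Rmin (1 / (1 + b) + (a + 2 * b) / (a ^ 2 + 2 * a + 2 + 2 * b * (a + 1)))
          (1 / sqrt (a * b) + 1 / a)) /\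
  Rbar_le (sup_lipschitz1 (fun f => sup_norm (delta (delta (g f)))))
    (2 / a + b / ((a + 1) * b + 1 + a / 2)).
Proof.
assert (Hdec : forall f, lipschitz1 f ->
          decaying_solution a b f (g f) (expect (pbd a b) f))
  by (intros f Hf; apply stein_solution_decaying; auto).
assert (Hex : forall f, lipschitz1 f -> exists g c, decaying_solution a b f g c)
  by (intros f Hf; exists (g f), (expect (pbd a b) f); auto).
assert (Hh : decaying_solution a b INR (g INR) (expect (pbd a b) INR)).
{ apply Hdec; intros x y; lra. }
assert (Hab : 0 < a * b) by now apply Rmult_lt_0_compat.
assert (Hr := sqrt_lt_R0 _ Hab).
assert (Hdelta : forall f, lipschitz1 f -> forall i,
  Rabs (delta (g f) i) <=
  Rmin (1 / (1 + b) + (a + 2 * b) / (a ^ 2 + 2 * a + 2 + 2 * b * (a + 1)))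
       (1 / sqrt (a * b) + 1 / a)).
{ intros f Hf i; destruct i as [|k].
  (* The convention [g 0 = g 1] makes this difference vanish. *)
  - unfold delta; rewrite (proj2 (hg f Hf)), Rminus_diag, Rabs_R0.
    apply Rmin_glb; apply Rplus_le_le_0_compat; apply Rlt_le;
      apply Rdiv_lt_0_compat; nra.
  - destruct (Hex (fun x => INR (x - S k))) as [p [cp Hp]].
    { apply lipschitz1_step; intros j; rewrite positive_part_step.
      destruct (Nat.leb (S k) j); rewrite ?Rabs_R0, ?Rabs_R1; lra. }
    destruct (positive_part_delta_le a b ha hb p cp k Hp) as [H1 H2].
    assert (H := lipschitz_solution_delta_le a b ha hb Hex _ _ Hh _ _ _ Hf
                   (Hdec f Hf) p cp k Hp).
    unfold delta; rewrite Rabs_minus_sym.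
    replace (1 / (2 * (1 + b))) with (1 / (1 + b) / 2) in H1 by (field; lra).
    replace (1 / (2 * sqrt (a * b))) with (1 / sqrt (a * b) / 2) in H2
      by (field; lra).
    generalize (identity_solution_increment_1 a b ha hb _ _ Hh)
      (identity_solution_increment_2 a b ha hb _ _ Hh).
    unfold backward_delta in *; intros; apply Rmin_glb; lra. }
split; [|split]; apply sup_lipschitz1_le; intros f Hf i.
- assert (H : forall k, Rabs (g f (S k)) <= - g INR 1%nat)
    by (intros k; exact (lipschitz_solution_le a b ha hb _ _ Hh _ _ _ Hf
                           (Hdec f Hf) k)).
  apply Rle_trans with (- g INR 1%nat).
  + destruct i as [|k]; [rewrite (proj2 (hg f Hf))|]; apply H.
  + apply Rmin_glb.
    * exact (identity_solution_bound_1 a b ha hb _ _ Hh).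
    * exact (identity_solution_bound_2 a b ha hb _ _ Hh).
- now apply Hdelta.
- destruct i as [|k].
  + assert (H := lipschitz_solution_le a b ha hb _ _ Hh _ _ _ Hf (Hdec f Hf) 0).
    assert (H1 := identity_solution_first_le a b ha hb _ _ Hh).
    assert (Hstep := lipschitz1_step_le f 0 Hf).
    (* At index 0 the second difference is [g 2 - g 1], and the equations at 0 and 1 give
       [a * (g 2 - g 1) = g 1 + f 1 - f 0], of modulus at most 2. *)
    generalize (proj1 (hg f Hf) 0%nat) (proj1 (hg f Hf) 1%nat).
    rewrite death_rate_S, death_rate_0; simpl (INR 0); intros E0 E1.
    unfold delta; rewrite (proj2 (hg f Hf)).
    assert (0 < b / ((a + 1) * b + 1 + a / 2))
      by (apply Rdiv_lt_0_compat; lra).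
    apply Rle_trans with (2 / a); [|lra].
    apply Rle_div_r; [exact ha|].
    rewrite <- (Rabs_right a) at 1 by lra; rewrite <- Rabs_mult.
    apply Rabs_le_between in H; apply Rabs_le_between in Hstep.
    apply Rabs_le; lra.
  + replace (delta (delta (g f)) (S k))
      with (backward_delta (backward_delta (g f)) (S k))
      by (unfold delta, backward_delta; ring).
    exact (lipschitz_solution_delta2_le a b ha hb Hex _ _ Hh _ _ _ Hf
             (Hdec f Hf) k).
Qed.
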